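(* Let $r\ge 1$ and $k\ge 1$ be integers, let $n=2^k$, and let $V_1,\dots,V_n$ be finite-dimensional vector spaces over a field $K$ with $\dim V_i\ge r$ for all $i$. Let $r'$ be a non-negative integer with $r'<r^{\lceil k/2\rceil}$. Then for every ordering of the leaves of the train track tree, i.e. for every permutation $\sigma$ of $\{1,\dots,n\}$, $$HF(r,k)\not\subseteq TT_\sigma(r',2^k)$$ as subsets of $V_1\otimes\dots\otimes V_n$.
   Context: All trees are finite rooted full binary trees: each vertex has either exactly two children (a node) or no children (a leaf). For a vertex $v$, $\downarrow v$ denotes the set of leaves that are descendants of $v$ (if $v$ is a leaf, $\downarrow v=\{v\}$). Tensor network states: let $\mathfrak T$ be such a tree whose leaves are labelled bijectively by $\{1,\dots,n\}$, and let $f$ be a function from the vertices of $\mathfrak T$ to the non-negative integers. $TNS_{\mathfrak T,f}\subset V_1\otimes\dots\otimes V_n$ is the set of tensors $t$ for which there exist linear subspaces $U_v$ with $\dim U_v\le f(v)$, one for each vertex $v$, such that: $U_v\subset V_i$ if $v$ is the leaf labelled $i$; $U_v\subset U_{v_1}\otimes U_{v_2}$ if $v$ is a node with children $v_1,v_2$; and $t\in U_{\mathfrak r}$ for the root $\mathfrak r$. (Tensor factors are rearranged according to their labels.) For an integer $r$, $TNS_{\mathfrak T,r}$ means $TNS_{\mathfrak T,f}$ with $f$ constant equal to $r$. Perfect binary tree of depth $k$ with the standard left-to-right labelling: the full binary tree with $2^k$ leaves in which every leaf has exactly $k$ ancestors, labelled so that the sets $\downarrow v$ are exactly the sets $\{2^m(i-1)+1,\dots,2^m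 i\}$ for $0\le m\le k$, $1\le i\le 2^{k-m}$. $HF(r,k)$ denotes $TNS_{\mathfrak T,r}$ for this labelled tree. Train track tree with $n$ leaves: the full binary tree with $n$ leaves in which each node has at least one leaf as a child. With the leaves ordered by $\sigma$, the sets $\downarrow v$ are exactly the singletons $\{\sigma(j)\}$, $1\le j\le n$, and the sets $\{\sigma(1),\dots,\sigma(j)\}$, $2\le j\le n$. $TT_\sigma(r',n)$ denotes $TNS_{\mathfrak T,r'}$ for this labelled tree. *)

(* Defs.v *)
From HB Require Import structures.
From mathcomp Require Import all_boot all_order all_fingroup all_algebra.

Set Implicit Arguments.
Unset Strict Implicit.
Unset Printing Implicit Defensive.

Import GRing.Theory.
Local Open Scope ring_scope.

Section TensorProduct.
Variable K : fieldType.

Definition mindex (J : finType) (W : J -> vectType K) : finType :=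
  {dffun forall j : J, 'I_(\dim {: W j})}.

(* The tensor product of the family W, presented by coordinates in the basis
   of tensor products of the vectors of the bases [vbasis {: W j}]; see [tpure]
   and [tpure_vbasis] below. *)
Definition tensor (J : finType) (W : J -> vectType K) : vectType K :=
  {ffun mindex W -> K^o}.

Definition tpure (J : finType) (W : J -> vectType K) (w : forall j, W j) :
    tensor W :=
  [ffun x : mindex W => \prod_j coord (vbasis {: W j}) (x j) (w j)].

Lemma tpure_vbasis (J : finType) (W : J -> vectType K) (x y : mindex W) :
  tpure (fun j => (vbasis {: W j})`_(x j)) y = (x == y)%:R.
Proof.
rewrite ffunE; case: eqP => [<-|ne_xy].
  rewrite big1 // => j _; rewrite coord_free ?eqxx //.
  exact: basis_free (vbasisP _).
have [j ne_j] : exists j, x j != y j.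
  apply/existsP; apply: contra_notT ne_xy => /existsPn eq_xy.
  by apply/ffunP => j; apply/eqP/negPn/eq_xy.
rewrite (bigD1 j) //= coord_free; last exact: basis_free (vbasisP _).
by rewrite -val_eqE /= eq_sym in ne_j *; rewrite (negPf ne_j) mul0r.
Qed.

Lemma tpure_multilinear (J : finType) (W : J -> vectType K) (a : K) (j0 : J)
    (u v w : forall j, W j) :
    w j0 = a *: u j0 + v j0 ->
    (forall j, j != j0 -> w j = u j) -> (forall j, j != j0 -> w j = v j) ->
  tpure w = a *: tpure u + tpure v.
Proof.
move=> w0 wu wv; apply/ffunP => x; rewrite !ffunE.
rewrite (bigD1 j0) // [X in _ = _ *: X + _](bigD1 j0) //.
rewrite [X in _ = _ + X](bigD1 j0) //= w0 linearP /= mulrDl.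
congr (_ + _); last by congr (_ * _); apply: eq_bigr => j /wv ->.
by rewrite -!mulrA; congr (_ * (_ * _)); apply: eq_bigr => j /wu ->.
Qed.

Variables (I : finType) (V : I -> vectType K).
Implicit Types A B : {set I}.

Definition tensor_on A : vectType K :=
  tensor (fun i : {i | i \in A} => V (val i)).

Definition mindex_on A : finType :=
  mindex (fun i : {i | i \in A} => V (val i)).

Definition sub_elt A B (sAB : A \subset B) (i : {i | i \in A}) :
    {i | i \in B} :=
  exist _ (val i) (subsetP sAB _ (valP i)).

Definition mrestr A B (sAB : A \subset B) (x : mindex_on B) : mindex_on A :=
  [ffun i => x (sub_elt sAB i)].

Definition mrestrT A (x : mindex V) : mindex_on A := [ffun i => x (val i)].

(* For disjoint A and B, the canonical bilinear map from the product of
   [tensor_on A] and [tensor_on B] to their tensor product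
   [tensor_on (A :|: B)], factors being arranged by label. *)
Definition tmul A B (s : tensor_on A) (t : tensor_on B) :
    tensor_on (A :|: B) :=
  [ffun x => s (mrestr (subsetUl A B) x) * t (mrestr (subsetUr A B) x)].

Lemma tmul_linearl A B (t : tensor_on B) :
  linear (fun s : tensor_on A => tmul s t).
Proof. by move=> a u v; apply/ffunP => x; rewrite !ffunE mulrDl scalerAl. Qed.

Lemma tmul_linearr A B (s : tensor_on A) :
  linear (fun t : tensor_on B => tmul s t).
Proof. by move=> a u v; apply/ffunP => x; rewrite !ffunE mulrDr scalerAr. Qed.

Lemma big_sub_elt A B (sAB : A \subset B) (F : {i | i \in B} -> K) :
  \prod_(i | val i \in A) F i = \prod_i F (sub_elt sAB i).
Proof.
rewrite (reindex_omap (sub_elt sAB) (fun i => insub (val i))) /=.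
  by apply: eq_bigl => i; rewrite valK eqxx (valP i).
by move=> i iA; rewrite insubT /=; congr Some; apply: val_inj.
Qed.

Lemma tmul_tpure A B (w : forall i, V i) : [disjoint A & B] ->
  tmul (tpure (fun i : {i | i \in A} => w (val i)))
       (tpure (fun i : {i | i \in B} => w (val i))) =
  tpure (fun i : {i | i \in A :|: B} => w (val i)).
Proof.
move=> dAB; apply/ffunP => x; rewrite !ffunE [RHS](bigID (fun i => val i \in A)).
congr (_ * _).
  rewrite (big_sub_elt (subsetUl A B)).
  by apply: eq_bigr => i _; rewrite ffunE.
rewrite (eq_bigl (fun i : {i | i \in A :|: B} => val i \in B)); last first.
  move=> [i /= iAB]; move: (iAB); rewrite inE.
  by case: (boolP (i \in A)) => //= /(disjointFr dAB) ->.
rewrite (big_sub_elt (subsetUr A B)).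
by apply: eq_bigr => i _; rewrite ffunE.
Qed.

(* The subspace U (x) W of [tensor_on (A :|: B)]; see [tensvP]. *)
Definition tensv A B (U : {vspace tensor_on A}) (W : {vspace tensor_on B}) :
    {vspace tensor_on (A :|: B)} :=
  <<[seq tmul u w | u <- vbasis U, w <- vbasis W]>>%VS.

Lemma tensvP A B (U : {vspace tensor_on A}) (W : {vspace tensor_on B})
    (X : {vspace tensor_on (A :|: B)}) :
  (forall u w, u \in U -> w \in W -> tmul u w \in X) <-> (tensv U W <= X)%VS.
Proof.
split=> [UWX | /span_subvP UWX u w Uu Ww].
  apply/span_subvP => _ /allpairsP[[u w] [/= Uu Ww ->]].
  by apply: UWX; apply: vbasis_mem.
pose gl t := GRing.isLinear.Build K _ _ _ _ (@tmul_linearl A B t).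
pose gr s := GRing.isLinear.Build K _ _ _ _ (@tmul_linearr A B s).
pose fl t : {linear _ -> _} := HB.pack (fun s : tensor_on A => tmul s t) (gl t).
pose fr s : {linear _ -> _} := HB.pack (fun t : tensor_on B => tmul s t) (gr s).
rewrite (coord_vbasis Uu) -[tmul _ w]/(fl w _) linear_sum memv_suml // => i _.
rewrite linearZ memvZ //= (coord_vbasis Ww).
rewrite -[tmul _ _]/(fr (vbasis U)`_i _) linear_sum memv_suml // => j _.
rewrite linearZ memvZ //=; apply: UWX.
by apply: allpairs_f; rewrite mem_nth ?size_tuple.
Qed.

(* For A = [set: I], the canonical isomorphism from [tensor_on A] to the tensor
   product of the whole family. *)
Definition tfull A (s : tensor_on A) : tensor V :=
  [ffun x => s (mrestrT A x)].

Lemma tfull_tpure A (w : forall i, V i) : A = [set: I] ->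
  tfull (tpure (fun i : {i | i \in A} => w (val i))) = tpure w.
Proof.
move=> AT; apply/ffunP => x; rewrite !ffunE.
rewrite [RHS](reindex_omap (fun i : {i | i \in A} => val i) insub) /=.
  by apply: eq_big => [i|i _]; rewrite ?valK ?eqxx ?ffunE.
by move=> i _; rewrite insubT //= AT inE.
Qed.

End TensorProduct.

Section Trees.
Variable I : finType.

Inductive tree : Type := Leaf of I | Node of tree & tree.

Fixpoint leaves (t : tree) : seq I :=
  match t with Leaf i => [:: i] | Node l r => leaves l ++ leaves r end.

Definition bij_labelled (t : tree) : Prop := perm_eq (leaves t) (enum I).

Fixpoint leafset (t : tree) : {set I} :=
  match t with Leaf i => [set i] | Node l r => leafset l :|: leafset r end.

(* A vertex is represented by the subtree rooted at it, so that [leafset v] is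
   its set of descendant leaves. When the leaf labels are pairwise distinct, so
   are the subtrees rooted at different vertices. *)
Fixpoint vertex (v t : tree) : Prop :=
  v = t \/
  match t with Leaf _ => False | Node l r => vertex v l \/ vertex v r end.

Lemma leafsetE (t : tree) : leafset t = [set i in leaves t].
Proof.
elim: t => [i|l IHl r IHr] /=; apply/setP => j; first by rewrite !inE.
by rewrite IHl IHr !inE mem_cat.
Qed.

Lemma leafset_bij (t : tree) : bij_labelled t -> leafset t = [set: I].
Proof.
by move=> bt; apply/setP => i; rewrite leafsetE !inE (perm_mem bt) mem_enum.
Qed.

End Trees.

Section TensorNetworkStates.
Variables (K : fieldType) (I : finType) (V : I -> vectType K).

(* Meant for bijectively labelled t. The condition at a leaf labelled i is in
   the type of U, since [tensor_on V [set i]] is V i. *)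
Definition TNS (t : tree I) (f : tree I -> nat) (x : tensor V) : Prop :=
  exists U : forall v : tree I, {vspace tensor_on V (leafset v)},
    [/\ forall v, vertex v t -> (\dim (U v) <= f v)%N,
        forall l r, vertex (Node l r) t ->
          (U (Node l r) <= tensv (U l) (U r))%VS
      & exists2 u : tensor_on V (leafset t), u \in U t & x = tfull u].

End TensorNetworkStates.

Lemma exp2_double m : (2 ^ m + 2 ^ m = 2 ^ m.+1)%N.
Proof. by rewrite addnn -mul2n -expnS. Qed.

Fixpoint perfect_tree (I : finType) (m : nat) : ('I_(2 ^ m) -> I) -> tree I :=
  match m with
  | 0 => fun lab => Leaf (lab ord0)
  | p.+1 => fun lab =>
      Node
        (perfect_tree (fun i => lab (cast_ord (exp2_double p) (lshift _ i))))
        (perfect_tree (fun i => lab (cast_ord (exp2_double p) (rshift _ i))))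
  end.

Definition train_tree (I : finType) (x : I) (s : seq I) : tree I :=
  foldl (fun t y => Node t (Leaf y)) (Leaf x) s.

Definition HF (K : fieldType) (r k : nat) (V : 'I_(2 ^ k) -> vectType K) :
    tensor V -> Prop :=
  TNS (perfect_tree id) (fun=> r).

(* The list [codom sigma] is sigma(0), ..., sigma(n-1); it is empty only when
   n = 0, in which case there is no tree. *)
Definition TT (K : fieldType) (n : nat) (V : 'I_n -> vectType K)
    (sigma : 'S_n) (r' : nat) (x : tensor V) : Prop :=
  match codom sigma with
  | [::] => False
  | i :: s => TNS (train_tree i s) (fun=> r') x
  end.

Lemma leaves_perfect (I : finType) m (lab : 'I_(2 ^ m) -> I) :
  leaves (perfect_tree lab) = codom lab.
Proof.
elim: m lab => [|m IHm] lab /=.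
  rewrite /codom /image_mem enumT unlock /= /ord_enum /=.
  by rewrite insubT /=; congr [:: lab _]; apply: val_inj.
rewrite !IHm /codom /image_mem.
have -> : enum 'I_(2 ^ m.+1) =
    [seq cast_ord (exp2_double m) (lshift _ i) | i <- enum 'I_(2 ^ m)] ++
    [seq cast_ord (exp2_double m) (rshift _ i) | i <- enum 'I_(2 ^ m)].
  apply: (inj_map val_inj); rewrite map_cat.
  rewrite -(map_comp val _ (enum _)) -(map_comp val _ (enum _)) val_enum_ord.
  have -> : iota 0 (2 ^ m.+1) = iota 0 (2 ^ m) ++ map (addn (2 ^ m)) (iota 0 (2 ^ m)).
    by rewrite -exp2_double iotaD -iotaDl addn0.
  by rewrite -val_enum_ord -map_comp.
by rewrite map_cat -(map_comp lab) -(map_comp lab).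
Qed.

Lemma perfect_bij_labelled k :
  bij_labelled (perfect_tree (fun i : 'I_(2 ^ k) => i)).
Proof.
by rewrite /bij_labelled leaves_perfect /codom /image_mem map_id.
Qed.

Lemma leaves_train (I : finType) (x : I) (s : seq I) :
  leaves (train_tree x s) = x :: s.
Proof.
rewrite /train_tree -[RHS]/(leaves (Leaf x) ++ s).
elim: s (Leaf x) => [|y s IHs] t /=; first by rewrite cats0.
by rewrite IHs /= -catA.
Qed.

Lemma train_bij_labelled n (sigma : 'S_n) i s :
  codom sigma = i :: s -> bij_labelled (train_tree i s).
Proof.
move=> Es; rewrite /bij_labelled leaves_train -Es; apply: uniq_perm.
- by rewrite map_inj_uniq ?enum_uniq //; apply: perm_inj.
- exact: enum_uniq.
by move=> j; rewrite mem_enum -[j](permKV sigma) codom_f.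
Qed.

Lemma leafset_perfect (I : finType) m (lab : 'I_(2 ^ m) -> I) (A : {set I}) :
  (exists2 v, vertex v (perfect_tree lab) & leafset v = A) <->
  (exists p q, [/\ (p <= m)%N, (q < 2 ^ (m - p))%N &
     A = [set lab j | j : 'I_(2 ^ m) & (2 ^ p * q <= j < 2 ^ p * q.+1)%N]]).
Proof.
have rootE n (lb : 'I_(2 ^ n) -> I) :
    leafset (perfect_tree lb) = [set lb j | j : 'I_(2 ^ n)].
  rewrite leafsetE leaves_perfect; apply/setP => y; rewrite inE.
  by apply/codomP/imsetP => [[j ->]|[j _ ->]]; exists j.
have allE n (lb : 'I_(2 ^ n) -> I) : [set lb j | j : 'I_(2 ^ n)] =
    [set lb j | j : 'I_(2 ^ n) & (2 ^ n * 0 <= j < 2 ^ n * 1)%N].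
  rewrite muln0 muln1; apply/setP => y.
  by apply/imsetP/imsetP=> [[j]|[j]] _ ->; exists j; rewrite // inE ltn_ord.
elim: m lab A => [|m IHm] lab A.
  split=> [[v [->|//] <-]|[p [q [p0 q0 ->]]]].
    exists 0, 0; split=> //; rewrite -allE.
    by rewrite -[LHS]/(leafset (perfect_tree lab)) rootE.
  move: p0 q0; rewrite leqn0 => /eqP ->; rewrite ltnS leqn0 => /eqP ->.
  by exists (perfect_tree lab); [left | rewrite rootE allE].
pose ll i := lab (cast_ord (exp2_double m) (lshift _ i)).
pose lr i := lab (cast_ord (exp2_double m) (rshift _ i)).
have llE p q : (p <= m)%N -> (q < 2 ^ (m - p))%N ->
    [set ll j | j : 'I_(2 ^ m) & (2 ^ p * q <= j < 2 ^ p * q.+1)%N] =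
    [set lab j | j : 'I_(2 ^ m.+1) & (2 ^ p * q <= j < 2 ^ p * q.+1)%N].
  move=> pm qm; have bnd : (2 ^ p * q.+1 <= 2 ^ m)%N.
    by rewrite -[in leqRHS](subnKC pm) expnD leq_pmul2l ?expn_gt0.
  apply/setP => y; apply/imsetP/imsetP=> [[j]|[j]]; rewrite inE => jP ->.
    by exists (cast_ord (exp2_double m) (lshift _ j)); rewrite ?inE.
  have jm : (j < 2 ^ m)%N by case/andP: jP => _ /leq_trans->.
  by exists (Ordinal jm); rewrite ?inE //; congr lab; apply: val_inj.
have lrE p q : (p <= m)%N ->
    [set lr j | j : 'I_(2 ^ m) & (2 ^ p * q <= j < 2 ^ p * q.+1)%N] =
    [set lab j | j : 'I_(2 ^ m.+1) &
      (2 ^ p * (2 ^ (m - p) + q) <= j < 2 ^ p * (2 ^ (m - p) + q).+1)%N].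
  move=> pm; rewrite -addnS !mulnDr -expnD subnKC //.
  apply/setP => y; apply/imsetP/imsetP=> [[j]|[j]]; rewrite inE => jP ->.
    exists (cast_ord (exp2_double m) (rshift _ j)); rewrite // inE /=.
    by rewrite leq_add2l ltn_add2l.
  have mj : (2 ^ m <= j)%N by case/andP: jP => /(leq_trans (leq_addr _ _)).
  have jm : (j - 2 ^ m < 2 ^ m)%N.
    by rewrite ltn_subLR // exp2_double.
  exists (Ordinal jm); first by rewrite inE /= leq_subRL // ltn_subLR.
  by congr lab; apply: val_inj; rewrite /= subnKC.
split=> [[v [->|[vl|vr]] <-]|[p [q []]]].
- exists m.+1, 0; split; rewrite ?expn_gt0 // -allE.
  by rewrite -[LHS]/(leafset (perfect_tree lab)) rootE.
- have /IHm[p [q [pm qm ->]]] :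
    exists2 u, vertex u (perfect_tree ll) & leafset u = leafset v by exists v.
  exists p, q; split; rewrite ?llE ?(leqW pm) //.
  by rewrite subSn // (ltn_trans qm) // ltn_exp2l.
- have /IHm[p [q [pm qm ->]]] :
    exists2 u, vertex u (perfect_tree lr) & leafset u = leafset v by exists v.
  exists p, (2 ^ (m - p) + q)%N; split; rewrite ?lrE ?(leqW pm) //.
  by rewrite subSn // -exp2_double ltn_add2l.
rewrite leq_eqVlt => /predU1P[->|]; last rewrite ltnS => pm.
  rewrite subnn ltnS leqn0 => /eqP -> ->.
  by exists (perfect_tree lab); [left | rewrite rootE allE].
rewrite subSn // -exp2_double => qm AE.
case: (ltnP q (2 ^ (m - p))) => [q_lt|q_ge].
  have /IHm[v vl vA] : exists p' q', [/\ (p' <= m)%N, (q' < 2 ^ (m - p'))%N &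
     A = [set ll j | j : 'I_(2 ^ m) & (2 ^ p' * q' <= j < 2 ^ p' * q'.+1)%N]].
    by exists p, q; rewrite llE.
  by exists v => //; right; left.
have /IHm[v vr vA] : exists p' q', [/\ (p' <= m)%N, (q' < 2 ^ (m - p'))%N &
   A = [set lr j | j : 'I_(2 ^ m) & (2 ^ p' * q' <= j < 2 ^ p' * q'.+1)%N]].
  by exists p, (q - 2 ^ (m - p))%N; rewrite lrE // ltn_subLR // subnKC.
by exists v => //; right; right.
Qed.

Lemma leafset_train (I : finType) (x : I) (s : seq I) (A : {set I}) :
  (exists2 v, vertex v (train_tree x s) & leafset v = A) <->
  (exists2 y, y \in x :: s & A = [set y]) \/
  (exists2 j, (2 <= j <= (size s).+1)%N & A = [set y in take j (x :: s)]).
Proof.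
elim/last_ind: s A => [|s z IHs] A.
  split=> [[v [->|//] <-]|[[y]|[j]]] /=; first by left; exists x; rewrite ?mem_head.
    by rewrite inE => /eqP -> ->; exists (Leaf x); first by left.
  by case/andP => j2 /(leq_trans j2).
have rootE : leafset (train_tree x (rcons s z)) = [set y in x :: rcons s z].
  by rewrite leafsetE leaves_train.
rewrite /train_tree -cats1 foldl_cat cats1 /= -/(train_tree x s) in rootE *.
split=> [[v [->|[vs|[->|//]]] <-]|].
- right; exists (size s).+2; first by rewrite size_rcons ltnS leqnn.
  by rewrite /= rootE take_oversize ?size_rcons.
- have /IHs : exists2 u, vertex u (train_tree x s) & leafset u = leafset v.
    by exists v.
  case=> [[y ys ->]|[j /andP[j2 js] ->]].
    by left; exists y; rewrite // -rcons_cons mem_rcons inE ys orbT.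
  right; exists j; first by rewrite size_rcons j2 ltnW.
  by rewrite -rcons_cons -cats1 takel_cat.
- by left; exists z; rewrite // -rcons_cons mem_rcons mem_head.
case=> [[y]|[j]]; rewrite ?size_rcons.
  rewrite -rcons_cons mem_rcons inE => /predU1P[->|ys] ->.
    by exists (Leaf z) => //; right; right; left.
  have /IHs[v vs <-] : (exists2 y', y' \in x :: s & [set y] = [set y']) \/
      (exists2 j, 2 <= j <= (size s).+1 & [set y] = [set y in take j (x :: s)])%N.
    by left; exists y.
  by exists v => //; right; left.
rewrite [X in _ && X]leq_eqVlt andb_orr => /orP[/andP[_ /eqP ->]|jlt] ->.
  exists (Node (train_tree x s) (Leaf z)); first by left.
  by rewrite /= rootE take_oversize ?size_rcons.
have /andP[_ js] := jlt.
have /IHs[v vs vE] : (exists2 y, y \in x :: s & [set y in take j (x :: s)] = [set y]) \/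
      (exists2 i, 2 <= i <= (size s).+1 & [set y in take j (x :: s)] = [set y in take i (x :: s)])%N.
  by right; exists j.
exists v; first by right; left.
by rewrite vE -rcons_cons -cats1 takel_cat.
Qed.

(* Main.v *)
(** Let an involution [pr] pair the leaves it moves; put the identity
    tensor of size [r] on every pair and a fixed vector on every unpaired
    leaf.  If the paths joining the pairs in the tree are edge disjoint, i.e. no vertex separates two pairs, then this tensor is
    a tensor network state of rank [r]; if a set A separates N pairs, its
    flattening along A has rank at least r ^ N.  On the other hand a train
    track state of rank [r'] has flattening rank at most [r'] along every
    prefix of the ordering.

    It remains to find a prefix and edge-disjoint paths in the perfect tree of
    depth k such that uphalf k of them are separated.  As for the pathwidth of
    the perfect binary tree, two more levels yield one more path: among three
    grandchildren of the root take the one whose good prefix comes second;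
    at that moment the first grandchild has a leaf in the prefix and the third
    one has a leaf outside it, and the path joining these avoids the second. *)
Require Import Defs.
From HB Require Import structures.
From mathcomp Require Import all_boot all_order all_fingroup all_algebra.
From mathcomp Require Import zify.

Set Implicit Arguments.
Unset Strict Implicit.
Unset Printing Implicit Defensive.

Import GRing.Theory.
Local Open Scope ring_scope.

(** * Edge-disjoint pairings and the prefixes they cross *)

Section Pairings.
Variable I : finType.
Implicit Types (t u v l r A B T : tree I) (pr : I -> I).

Lemma vertex_refl t : vertex t t.
Proof. by case: t => [i|l r]; left. Qed.

Lemma vertex_trans u v t : vertex u v -> vertex v t -> vertex u t.
Proof.
elim: t => [i|l IHl r IHr] uv; first by case=> // <-.
by case=> [<- //|[/IHl|/IHr] ut]; right; [left|right]; apply: ut.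
Qed.

Lemma vertex_leafset v t : vertex v t -> leafset v \subset leafset t.
Proof.
elim: t => [i|l IHl r IHr] /=; first by case=> // ->.
by case=> [-> //|[/IHl|/IHr] /subset_trans->]; rewrite ?subsetUl ?subsetUr.
Qed.

Lemma uniq_leaves_node l r : uniq (leaves (Node l r)) ->
  [/\ uniq (leaves l), uniq (leaves r) & [disjoint leafset l & leafset r]].
Proof.
rewrite /= cat_uniq => /and3P[-> /hasPn lr ->]; split=> //.
rewrite !leafsetE disjoint_sym disjoint_subset.
by apply/subsetP => i; rewrite !inE => /lr.
Qed.

Lemma vertex_uniq v t : vertex v t -> uniq (leaves t) -> uniq (leaves v).
Proof.
elim: t => [i|l IHl r IHr]; first by case=> // ->.
by case=> [-> //|[/IHl|/IHr] uv] /uniq_leaves_node[ul ur _]; apply: uv.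
Qed.

(** The first alternative gives a vertex of [u], not just an inclusion of leaf sets, so that
    conditions on the vertices of [u] apply to [v]. *)
Lemma vertex_laminar u v t : uniq (leaves t) -> vertex u t -> vertex v t ->
  [\/ vertex v u, leafset u \subset leafset v
    | [disjoint leafset u & leafset v]].
Proof.
elim: t => [i|l IHl r IHr] ut.
  by move=> [->|//] [->|//]; apply: Or31; apply: vertex_refl.
have [ul ur dlr] := uniq_leaves_node ut.
case=> [-> vt|uu]; first exact: Or31.
case=> [->|vv].
  apply: Or32; apply: (@vertex_leafset u (Node l r)); by right.
case: uu vv => [ul'|ur'] [vl|vr]; [exact: IHl | | | exact: IHr].
  apply: Or33; apply: disjointWl (vertex_leafset ul') _.
  exact: disjointWr (vertex_leafset vr) dlr.
apply: Or33; rewrite disjoint_sym; apply: disjointWl (vertex_leafset vl) _.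
exact: disjointWr (vertex_leafset ur') dlr.
Qed.

(* The last condition says that every vertex separates at most one pair. *)
Definition pairing t pr : Prop :=
  [/\ involutive pr, forall i, i \notin leafset t -> pr i = i
    & forall v i j, vertex v t -> i \in leafset v -> j \in leafset v ->
        pr i \notin leafset v -> pr j \notin leafset v -> i = j].

Lemma pairing_id t : pairing t id.
Proof. by split=> // v i j _ ->. Qed.

Lemma pairing_mem t pr i : pairing t pr -> pr i != i -> i \in leafset t.
Proof. by case=> _ fx _; apply: contraNT => /fx ->. Qed.

(** All pairs lie inside [T], so a vertex of [t] that contains every leaf of [T], or none, separates
    no pair. *)
Lemma pairing_widen T t pr : uniq (leaves t) -> vertex T t ->
  pairing T pr -> pairing t pr.
Proof.
move=> ut Tt pT; have [inv fx cut] := pT; split=> // [i it|v i j vt iv jv].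
  by apply: fx; apply: contra it; apply/subsetP/vertex_leafset.
case: (vertex_laminar ut Tt vt) => [vT|TV|dTv]; first exact: cut.
  case/negP; case: (eqVneq (pr i) i) => [->//|npri].
  by apply: (subsetP TV); apply: (pairing_mem pT); rewrite inv eq_sym.
case/negP; case: (eqVneq (pr i) i) => [->//|npri].
by rewrite (disjointFr dTv (pairing_mem pT npri)) in iv.
Qed.

(** [tau] stands for the position in an ordering. A pair is counted once, through its end inside the
    prefix of length [j]. *)
Definition crossing (tau : I -> nat) j pr : {set I} :=
  [set i | tau i < j <= tau (pr i)]%N.

(** The last hypothesis says that the path from [a] to [b] shares no edge with the paths of [pr];
    then [a] and [b] can be swapped on top of [pr]. *)
Lemma pairing_add t pr a b tau j : pairing t pr -> (tau a < j <= tau b)%N ->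
    a \in leafset t -> b \in leafset t -> pr a = a -> pr b = b ->
    (forall v, vertex v t -> (a \in leafset v) != (b \in leafset v) ->
       forall i, i \in leafset v -> pr i \in leafset v) ->
  exists2 pr', pairing t pr' &
    (#|crossing tau j pr| < #|crossing tau j pr'|)%N.
Proof.
move=> [inv fx cut] /andP[tauj jtau] at_ bt pa pb stab.
have ab : a != b by apply: contraTneq jtau => <-; rewrite -ltnNge.
have prI := inv_inj inv.
have pE i : i != a -> i != b -> tperm a b (pr i) = pr i.
  move=> ia ib; rewrite tpermD // eq_sym; first by rewrite -{1}pa (inj_eq prI).
  by rewrite -{1}pb (inj_eq prI).
exists (tperm a b \o pr); first split.
- move=> i /=; case: (eqVneq i a) => [->|ia].
    by rewrite pa tpermL pb tpermR.
  case: (eqVneq i b) => [->|ib]; first by rewrite pb tpermR pa tpermL.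
  by rewrite (pE i) // inv tpermD // eq_sym.
- move=> i it /=; by rewrite pE ?fx //; apply: contraNneq it => ->.
- move=> v x y vt xv yv /=.
  (* If [v] separates [a] from [b], no old pair leaves [v], and only the new one does. Otherwise the
     new pair stays on one side and the bound for [pr] applies. *)
  have [abv|abv] := boolP ((a \in leafset v) != (b \in leafset v)); last first.
    have stay z : z \in leafset v -> tperm a b (pr z) \notin leafset v ->
        pr z \notin leafset v.
      move=> zv; move: abv; rewrite negbK => /eqP abv.
      case: (eqVneq z a) zv => [->|za] zv; first by rewrite pa tpermL -abv zv.
      case: (eqVneq z b) zv => [->|zb] zv; first by rewrite pb tpermR abv zv.
      by rewrite pE.
    by move=> /(stay _ xv) px /(stay _ yv) py; apply: (cut v).
  have mv z : z \in leafset v -> tperm a b (pr z) \notin leafset v ->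
      z = if a \in leafset v then a else b.
    move=> zv; case: (eqVneq z a) zv => [-> ->//|za] zv.
    case: (eqVneq z b) zv => [->|zb] zv.
      by rewrite zv eqb_id in abv; rewrite (negPf abv).
    by rewrite pE // stab.
  by move=> /(mv _ xv) -> /(mv _ yv) ->.
have aX : a \notin crossing tau j pr by rewrite inE pa tauj leqNgt tauj.
have <- : #|a |: crossing tau j pr| = #|crossing tau j pr|.+1.
  by rewrite cardsU1 aX.
apply/subset_leq_card/subsetP => i; rewrite !inE => /predU1P[->|].
  by rewrite /= pa tpermL tauj.
case: (eqVneq i a) => [->|ia]; first by rewrite pa ltnNge andNb.
case: (eqVneq i b) => [->|ib]; first by rewrite pb ltnNge andNb.
by rewrite /= pE.
Qed.

(* [j <= k <= l] are the moments at which the prefixes are good for [A], [T]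
   and [B]. *)
Lemma crossing_median t A T B tau (j k l : nat) prA prT prB m :
    uniq (leaves t) -> vertex A t -> vertex T t -> vertex B t ->
    [disjoint leafset A & leafset T] -> [disjoint leafset B & leafset T] ->
    pairing A prA -> pairing T prT -> pairing B prB ->
    (0 < #|crossing tau j prA|)%N -> (m <= #|crossing tau k prT|)%N ->
    (0 < #|crossing tau l prB|)%N -> (j <= k <= l)%N ->
  exists2 pr, pairing t pr & (m < #|crossing tau k pr|)%N.
Proof.
move=> ut At Tt Bt dA dB pA pT pB /card_gt0P[a] + mT /card_gt0P[b'] + /andP[jk kl].
rewrite !inE => /andP[aj ja] /andP[bl lb].
have aA : a \in leafset A.
  by apply: (pairing_mem pA); apply: contraTneq ja => ->; rewrite -ltnNge.
have bB : prB b' \in leafset B.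
  have [inv _ _] := pB; apply: (pairing_mem pB); rewrite inv.
  by apply: contraTneq bl => ->; rewrite -leqNgt.
have aT : a \notin leafset T by rewrite (disjointFr dA).
have bT : prB b' \notin leafset T by rewrite (disjointFr dB).
have [_ fx _] := pT; have pt := pairing_widen ut Tt pT.
(* The early end of a pair of [A] and the late end of a pair of [B] form the new pair, which crosses
   moment [k]. *)
have akb : (tau a < k <= tau (prB b'))%N.
  by rewrite (leq_trans aj jk) (leq_trans kl lb).
have [||||v vt abv i iv|pr ppr lt] := pairing_add pt akb; last 1 first.
- by exists pr => //; apply: leq_ltn_trans lt.
- exact: (subsetP (vertex_leafset At)).
- exact: (subsetP (vertex_leafset Bt)).
- exact: fx.
- exact: fx.
case: (eqVneq (prT i) i) => [->//|npi].
have iT := pairing_mem pT npi.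
have pi : prT i \in leafset T.
  by have [inv _ _] := pT; apply: (pairing_mem pT); rewrite inv eq_sym.
(* A vertex inside [T] contains neither end of the new pair; any other vertex contains all of [T] or
   none of it. *)
case: (vertex_laminar ut Tt vt) => [vT|/subsetP TV|dTv]; first 1 last.
- exact: TV.
- by rewrite (disjointFr dTv iT) in iv.
have /subsetP sv := vertex_leafset vT; move: abv.
by rewrite (contraNF (sv a) aT) (contraNF (sv _) bT).
Qed.

Lemma crossing_pair t a b tau : a \in leafset t -> b \in leafset t ->
    tau a != tau b ->
  exists j, exists2 pr, pairing t pr & (0 < #|crossing tau j pr|)%N.
Proof.
wlog ab : a b / (tau a < tau b)%N.
  move=> W at_ bt; case: ltngtP => // ab _; first by apply: (W a b); rewrite ?ltn_eqF.
  by apply: (W b a); rewrite ?ltn_eqF.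
move=> at_ bt _; exists (tau b).
have abt : (tau a < tau b <= tau b)%N by rewrite ab /=.
have [//|pr ppr lt] := pairing_add (pairing_id t) abt at_ bt erefl erefl.
by exists pr => //; apply: leq_trans lt.
Qed.

Lemma perfect_crossing m (lab : 'I_(2 ^ m) -> I) (tau : I -> nat) :
    injective lab -> injective tau -> (0 < m)%N ->
  exists j, exists2 pr, pairing (perfect_tree lab) pr &
    (uphalf m <= #|crossing tau j pr|)%N.
Proof.
move=> + tauI; have [n] := ubnP m; elim: n m lab => // n IHn m lab mn labI m0.
have ut : uniq (leaves (perfect_tree lab)).
  by rewrite leaves_perfect map_inj_uniq ?enum_uniq.
(* The induction descends two levels at a time, so depths 1 and 2 are the base cases; there one pair
   of distinct leaves is enough. *)
have [m2|m3] := leqP m 2.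
  have -> : uphalf m = 1 by case: m m0 m2 {lab labI mn ut} => [|[|[]]].
  have mem i : lab i \in leafset (perfect_tree lab).
    by rewrite leafsetE inE leaves_perfect codom_f.
  have lt0 : (0 < 2 ^ m)%N by rewrite expn_gt0.
  have lt1 : (1 < 2 ^ m)%N by rewrite -{1}(expn0 2) ltn_exp2l.
  by apply: (crossing_pair (mem (Ordinal lt0)) (mem (Ordinal lt1))); rewrite !inj_eq.
case: m lab mn labI m0 ut m3 => [|[|m]] // lab mn labI _ ut m3.
have sub f : injective f -> exists j, exists2 pr,
    pairing (perfect_tree (fun i : 'I_(2 ^ m) => lab (f i))) pr &
    (uphalf m <= #|crossing tau j pr|)%N.
  by move=> fI; apply: IHn; [lia| exact: inj_comp|lia].
have up0 : (0 < uphalf m)%N by lia.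
have castI p : injective (cast_ord (exp2_double p)) := @cast_ord_inj _ _ _.
have lI p := inj_comp (castI p) (@lshift_inj (2 ^ p) (2 ^ p)).
have rI p := inj_comp (castI p) (@rshift_inj (2 ^ p) (2 ^ p)).
(* The grandchildren left-left, left-right and right-left of the root. *)
have [j1 [pr1 p1 c1]] := sub _ (inj_comp (lI _) (lI _)).
have [j2 [pr2 p2 c2]] := sub _ (inj_comp (lI _) (rI _)).
have [j3 [pr3 p3 c3]] := sub _ (inj_comp (rI _) (lI _)).
move: ut p1 p2 p3; rewrite /comp /=.
set T1 := perfect_tree _; set T2 := perfect_tree _.
set T3 := perfect_tree _; set T4 := perfect_tree _.
rewrite -[_ ++ _]/(leaves (Node (Node T1 T2) (Node T3 T4))).
move: T1 T2 T3 T4 => T1 T2 T3 T4 ut p1 p2 p3; set t := Node _ _ in ut *.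
have [ul ur d] := uniq_leaves_node ut.
have [_ _ d12] := uniq_leaves_node ul.
have d13 := disjointWl (subsetUl _ _) (disjointWr (subsetUl _ _) d).
have d23 := disjointWl (subsetUr _ _) (disjointWr (subsetUl _ _) d).
have d21 := d12; have d31 := d13; have d32 := d23.
rewrite disjoint_sym in d21; rewrite disjoint_sym in d31.
rewrite disjoint_sym in d32.
have v1 : vertex T1 t by right; left; right; left; apply: vertex_refl.
have v2 : vertex T2 t by right; left; right; right; apply: vertex_refl.
have v3 : vertex T3 t by right; right; right; left; apply: vertex_refl.
have e1 := leq_trans up0 c1; have e2 := leq_trans up0 c2.
have e3 := leq_trans up0 c3.
have M A T B jA jT jB (pA pT pB : I -> I) :=
  @crossing_median t A T B tau jA jT jB pA pT pB (uphalf m) ut.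
(* The moments are sorted; the grandchild with the middle one takes the place of [T] in
   [crossing_median]. *)
case: (leqP j1 j2) => [j12|/ltnW j21].
  case: (leqP j2 j3) => [j23|/ltnW j32].
    by exists j2; apply: (M T1 T2 T3 j1 j2 j3 pr1 pr2 pr3); rewrite ?j12.
  case: (leqP j1 j3) => [j13|/ltnW j31].
    by exists j3; apply: (M T1 T3 T2 j1 j3 j2 pr1 pr3 pr2); rewrite ?j13.
  by exists j1; apply: (M T3 T1 T2 j3 j1 j2 pr3 pr1 pr2); rewrite ?j31.
case: (leqP j1 j3) => [j13|/ltnW j31].
  by exists j1; apply: (M T2 T1 T3 j2 j1 j3 pr2 pr1 pr3); rewrite ?j21.
case: (leqP j2 j3) => [j23|/ltnW j32].
  by exists j3; apply: (M T2 T3 T1 j2 j3 j1 pr2 pr3 pr1); rewrite ?j23.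
by exists j2; apply: (M T3 T2 T1 j3 j2 j1 pr3 pr2 pr1); rewrite ?j32.
Qed.
End Pairings.

(** * The tensor of a pairing as a tensor network state *)

Section PairTensor.
Variables (K : fieldType) (I : finType) (V : I -> vectType K).
Variables (r : nat) (pr : I -> I).
Implicit Types (B C : {set I}) (s : nat) (y : I -> nat).

(* [s] is the index carried by the edge above [B]; a single one suffices, since
   a vertex separates at most one pair. *)
Definition pair_ok B s y : bool :=
  [forall i in B, (y i < r)%N && (if pr i == i then y i == 0
     else if pr i \in B then y (pr i) == y i else y i == s)].

Lemma eq_pair_ok B s y1 y2 : {in B, y1 =1 y2} ->
  pair_ok B s y1 = pair_ok B s y2.
Proof.
move=> y12; apply: eq_forallb => i; case iB: (i \in B) => //=.
by rewrite y12 //; case: ifP => // _; case: ifP => // pB; rewrite y12.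
Qed.

(** A pair left open by [B] or by [C] stays open in the union, so one index [s] serves all three
    conditions. *)
Lemma pair_okU_closed B C s y :
    {in B, forall i, pr i \notin C} -> {in C, forall i, pr i \notin B} ->
  pair_ok (B :|: C) s y = pair_ok B s y && pair_ok C s y.
Proof.
move=> BC CB; apply/forall_inP/andP => [ok|[/forall_inP okB /forall_inP okC] i].
  split; apply/forall_inP => i iX; have := ok i; rewrite !inE iX ?orbT => /(_ isT).
    by rewrite (negPf (BC i iX)) orbF.
  by rewrite (negPf (CB i iX)).
rewrite !inE => /orP[iB|iC].
  by rewrite (negPf (BC i iB)) orbF; apply: okB.
by rewrite (negPf (CB i iC)); apply: okC.
Qed.

(** The pair of [i] is the only one separated by [B] and the only one separated by [C]. The union
    leaves no pair open, and both lower edges carry the index [y i]. *)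
Lemma pair_okU_open B C s y i : involutive pr -> [disjoint B & C] ->
    {in B, forall j, pr j \notin B -> j = i} ->
    {in C, forall j, pr j \notin C -> j = pr i} ->
    i \in B -> pr i \in C ->
  pair_ok (B :|: C) s y = pair_ok B (y i) y && pair_ok C (y i) y.
Proof.
move=> inv dBC Bi Ci iB piC.
have ni : (pr i == i) = false.
  by apply: contraTF iB => /eqP <-; rewrite (disjointFl dBC).
apply/forall_inP/andP => [ok|[/forall_inP okB /forall_inP okC] j].
  have := ok i; rewrite !inE iB piC orbT ni => /(_ isT)/andP[_ /eqP yi].
  split; apply/forall_inP => j jX; have := ok j; rewrite !inE jX ?orbT => /(_ isT).
    case: (boolP (pr j \in B)) => [//|pjB]; rewrite (Bi j jX pjB) ni piC eqxx.
    by case/andP=> ->.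
  case: (boolP (pr j \in C)) => [|pjC]; first by rewrite orbT.
  by rewrite (Ci j jX pjC) inv (eq_sym i) ni iB yi eqxx => /andP[-> _].
rewrite !inE => /orP[jB|jC].
  have := okB j jB; case: (boolP (pr j \in B)) => [//|pjB].
  rewrite (Bi j jB pjB) ni piC eqxx => /andP[-> _] /=.
  have := okC _ piC; rewrite inv (eq_sym i) ni.
  by rewrite (disjointFr dBC iB) => /andP[].
have := okC j jC; case: (boolP (pr j \in C)) => [|pjC]; first by rewrite orbT.
rewrite (Ci j jC pjC) inv iB (eq_sym i) ni => /andP[-> /= /eqP->]; exact: eqxx.
Qed.

(** Extension by 0 off [B] gives functions of one type for all [B], so [pair_ok] needs no transport
    between index types. *)
Definition mval B (x : mindex_on V B) (i : I) : nat :=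
  oapp (fun j => val (x j)) 0 (insub i).

Lemma mval_mrestr B C (sBC : B \subset C) (x : mindex_on V C) :
  {in B, mval (mrestr sBC x) =1 mval x}.
Proof.
move=> i iB; rewrite /mval !insubT ?(subsetP sBC) //= => iC.
by rewrite ffunE; congr (val (x _)); apply: val_inj.
Qed.

Lemma mval_mrestrT B (x : mindex V) : {in B, forall i, mval (mrestrT B x) i = x i}.
Proof. by move=> i iB; rewrite /mval insubT /= ffunE. Qed.

(** The part of the pairing tensor on [B], with the edge above [B] set to [s]. *)
Definition pair_vec B s : tensor_on V B :=
  [ffun x => (pair_ok B s (mval x))%:R].

Definition pair_space B : {vspace tensor_on V B} :=
  <<[seq pair_vec B s | s <- iota 0 r]>>%VS.

Lemma dim_pair_space B : (\dim (pair_space B) <= r)%N.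
Proof. by apply: leq_trans (dim_span _) _; rewrite size_map size_iota. Qed.

Lemma mem_pair_space B s : (s < r)%N -> pair_vec B s \in pair_space B.
Proof. by move=> sr; apply/memv_span/map_f; rewrite mem_iota. Qed.

Lemma tmul_pair_vec B C s (x : mindex_on V (B :|: C)) :
  tmul (pair_vec B s) (pair_vec C s) x =
  (pair_ok B s (mval x) && pair_ok C s (mval x))%:R.
Proof.
rewrite !ffunE -natrM mulnb.
by rewrite !(eq_pair_ok _ (@mval_mrestr _ _ _ x)).
Qed.

(** The condition at a node: a pair joining [B] to [C] is contracted by summing over its index;
    without such a pair the two vectors are multiplied. *)
Lemma pair_spaceU B C : involutive pr -> [disjoint B & C] ->
    {in B &, forall i j, pr i \notin B -> pr j \notin B -> i = j} ->
    {in C &, forall i j, pr i \notin C -> pr j \notin C -> i = j} ->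
  (pair_space (B :|: C) <= tensv (pair_space B) (pair_space C))%VS.
Proof.
move=> inv dBC Bc Cc; apply/span_subvP => _ /mapP[s + ->].
rewrite mem_iota add0n /= => sr.
have tm a : (a < r)%N -> tmul (pair_vec B a) (pair_vec C a) \in
    tensv (pair_space B) (pair_space C).
  move=> ar; apply: (tensvP _ _ _).2 (subvv _) _ _ _ _; exact: mem_pair_space.
have [/exists_inP[i iB piC]|/exists_inPn no] :=
    boolP [exists i in B, pr i \in C].
  have -> : pair_vec (B :|: C) s =
      \sum_(a < r) tmul (pair_vec B a) (pair_vec C a).
    apply/ffunP => x; rewrite sum_ffunE ffunE.
    under eq_bigr do rewrite tmul_pair_vec.
    have piB : pr i \notin B by rewrite (disjointFl dBC).
    have iC : pr (pr i) \notin C by rewrite inv (disjointFr dBC).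
    rewrite (@pair_okU_open B C s _ i) //; first last.
    - by move=> j jC pj; apply: Cc.
    - by move=> j jB pj; apply: Bc.
    have ni : (pr i == i) = false.
      by apply: contraNF piB => /eqP ->.
    have yi a : pair_ok B a (mval x) -> mval x i = a /\ (a < r)%N.
      move=> /forall_inP/(_ i iB); rewrite ni (negPf piB).
      by case/andP=> lt /eqP yia; rewrite -yia.
    (* Only the summand indexed by the coordinate at [i] can survive; if that coordinate is at least
       [r], both sides vanish. *)
    case: (ltnP (mval x i) r) => [lt|ge].
      rewrite (bigD1 (Ordinal lt)) //= big1 ?addr0 // => a ne.
      case: (boolP (pair_ok B a _)) => //= /yi[ya _].
      by rewrite -val_eqE /= ya eqxx in ne.
    rewrite big1 => [|a _].
      by case: (boolP (pair_ok B _ _)) => //= /yi[_]; rewrite ltnNge ge.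
    by case: (boolP (pair_ok B a _)) => //= /yi[ya]; rewrite -ya ltnNge ge.
  by apply: memv_suml => a _; apply: tm.
have -> : pair_vec (B :|: C) s = tmul (pair_vec B s) (pair_vec C s).
  apply/ffunP => x; rewrite tmul_pair_vec ffunE pair_okU_closed // => i iC.
  by apply: contraL iC => piB; rewrite -(inv i) no.
exact: tm.
Qed.

Lemma TNS_pair_vec (t : tree I) s : uniq (leaves t) -> pairing t pr ->
  (s < r)%N -> TNS t (fun=> r) (tfull (pair_vec (leafset t) s)).
Proof.
move=> ut [inv _ cut] sr; exists (fun v => pair_space (leafset v)); split.
- by move=> v _; apply: dim_pair_space.
- move=> a b ab.
  have [_ _ d] := uniq_leaves_node (vertex_uniq ab ut).
  have va : vertex a t by apply: vertex_trans ab; right; left; apply: vertex_refl.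
  have vb : vertex b t by apply: vertex_trans ab; right; right; apply: vertex_refl.
  by apply: pair_spaceU => // i j; apply: cut.
- by exists (pair_vec (leafset t) s); first exact: mem_pair_space.
Qed.
End PairTensor.

(** * Bounding flattening ranks by slices *)

Section Slices.
Variables (K : fieldType) (I : finType) (V : I -> vectType K).

(** The conclusion is stable under linear combinations of [u], so the products spanning [tensv U W]
    suffice. [P] will fix the coordinates outside a vertex. *)
Lemma tensv_slice (A B C : {set I}) (U : {vspace tensor_on V A})
    (W : {vspace tensor_on V B}) (X : {vspace tensor_on V C})
    (P : mindex V -> Prop) (u : tensor_on V (A :|: B)) :
    (forall s t, s \in U -> t \in W -> exists2 w, w \in X & forall x, P x ->
       s (mrestrT A x) * t (mrestrT B x) = w (mrestrT C x)) ->
    u \in tensv U W ->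
  exists2 w, w \in X & forall x, P x ->
    u (mrestrT (A :|: B) x) = w (mrestrT C x).
Proof.
move=> UW; rewrite /tensv => /(@coord_span _ _ _ (in_tuple _)) ->.
elim/big_ind: _ => [|u1 u2 [w1 w1X e1] [w2 w2X e2]|i _].
- by exists 0; rewrite ?mem0v // => x _; rewrite !ffunE.
- by exists (w1 + w2); rewrite ?memvD // => x Px; rewrite !ffunE e1 ?e2.
set c := coord _ _ _; move: c => c.
have /allpairsP[[s t] [/= sU tW ->]] : (in_tuple
    [seq tmul u w | u <- vbasis U, w <- vbasis W])`_i \in
    [seq tmul u w | u <- vbasis U, w <- vbasis W] by apply: mem_nth.
have [w wX e] := UW s t (vbasis_mem sU) (vbasis_mem tW).
exists (c *: w); rewrite ?memvZ // => x Px; rewrite !ffunE -e //.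
by congr (_ * (s _ * t _)); apply/ffunP => j; rewrite !ffunE.
Qed.

(** With the coordinates outside [v] fixed as in [z], every factor beside the path from the root to
    [v] becomes a scalar, and an element of [U v] remains. *)
Lemma tree_slice (t v : tree I)
    (U : forall v : tree I, {vspace tensor_on V (leafset v)}) (z : mindex V) u :
    uniq (leaves t) -> vertex v t ->
    (forall l r, vertex (Node l r) t ->
       (U (Node l r) <= tensv (U l) (U r))%VS) ->
    u \in U t ->
  exists2 w, w \in U v & forall x : mindex V,
    (forall i, i \notin leafset v -> x i = z i) ->
    u (mrestrT (leafset t) x) = w (mrestrT (leafset v) x).
Proof.
elim: t u => [i|l IHl r IHr] u ut; first by move=> [->|//] _ uU; exists u.
have [ul ur d] := uniq_leaves_node ut.
case=> [-> _ uU|vt sub uU]; first by exists u.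
have subl a b : vertex (Node a b) l -> (U (Node a b) <= tensv (U a) (U b))%VS.
  by move=> ab; apply: sub; right; left.
have subr a b : vertex (Node a b) r -> (U (Node a b) <= tensv (U a) (U b))%VS.
  by move=> ab; apply: sub; right; right.
move/(subvP (sub l r (vertex_refl _))): uU; apply: tensv_slice => s1 s2 s1U s2U.
case: vt => [vl|vr].
  have [w wU e] := IHl _ ul vl subl s1U.
  exists (s2 (mrestrT (leafset r) z) *: w); rewrite ?memvZ // => x xz.
  rewrite !ffunE mulrC -e //; congr (s2 _ * _); apply/ffunP => j; rewrite !ffunE.
  apply: xz; apply: contraL (valP j) => /(subsetP (vertex_leafset vl)) jl.
  by rewrite (disjointFr d).
have [w wU e] := IHr _ ur vr subr s2U.
exists (s1 (mrestrT (leafset l) z) *: w); rewrite ?memvZ // => x xz.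
rewrite !ffunE -e //; congr (s1 _ * _); apply/ffunP => j; rewrite !ffunE.
apply: xz; apply: contraL (valP j) => /(subsetP (vertex_leafset vr)) jr.
by rewrite (disjointFl d).
Qed.

(** The evaluations at the points [e c] are dual to the family [w], which is therefore free. *)
Lemma dim_ge_dual (X F : finType) (U : {vspace {ffun X -> K^o}})
    (w : F -> {ffun X -> K^o}) (e : F -> X) :
    (forall b, w b \in U) -> (forall b c, w b (e c) = (b == c)%:R) ->
  (#|F| <= \dim U)%N.
Proof.
move=> wU wE; pose ws := [tuple w (enum_val i) | i < #|F|].
have wsE (i : 'I_#|F|) : ws`_i = w (enum_val i).
  by rewrite -tnth_nth tnth_mktuple.
have fr : free ws.
  apply/freeP => k k0 i.
  have := congr1 (fun f : {ffun X -> K^o} => f (e (enum_val i))) k0.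
  rewrite sum_ffunE (bigD1 i) //= ffunE wsE wE eqxx ffunE.
  rewrite big1 ?addr0 => [|j ji]; first by rewrite -[_ *: _]/(_ * _) mulr1.
  by rewrite ffunE wsE wE (inj_eq enum_val_inj) (negPf ji) scaler0.
move: fr; rewrite /free size_tuple => /eqP <-; apply/dimvS/span_subvP.
by move=> _ /mapP[i _ ->].
Qed.

(** [Z b c] depends on [b] inside [v] and on [c] outside, so the flattening of [x] along [v]
    contains an identity matrix indexed by [F]. Its columns come from slices in [U v]. *)
Lemma TNS_flattening (t v : tree I) (f : tree I -> nat) (x : tensor V)
    (F : finType) (Z : F -> F -> mindex V) :
    uniq (leaves t) -> vertex v t -> TNS t f x ->
    (forall b c c' i, i \in leafset v -> Z b c i = Z b c' i) ->
    (forall b b' c i, i \notin leafset v -> Z b c i = Z b' c i) ->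
    (forall b c, x (Z b c) = (b == c)%:R) ->
  (#|F| <= f v)%N.
Proof.
move=> ut vt [U [dU sub [u uU ->]]] Zin Zout xZ.
apply: leq_trans (dU v vt).
(* Outside [v] the base point [Z c c] agrees with every [Z b c]. *)
have sl c := tree_slice (Z c c) ut vt sub uU.
have /fin_all_exists[w wP] c : exists w, w \in U v /\ forall x : mindex V,
    (forall i, i \notin leafset v -> x i = Z c c i) ->
    u (mrestrT (leafset t) x) = w (mrestrT (leafset v) x).
  by have [w wU e] := sl c; exists w.
apply: (dim_ge_dual (w := w) (e := fun b => mrestrT (leafset v) (Z b b))).
  by move=> c; case: (wP c).
move=> c b; rewrite eq_sym -xZ ffunE (wP c).2; last by move=> i; apply: Zout.
by congr (w c _); apply/ffunP => j; rewrite !ffunE; apply: Zin (valP j).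
Qed.
End Slices.

(** * Rank of the pairing tensor and comparison with train tracks *)

Lemma crossing_flattening (K : fieldType) (I : finType) (V : I -> vectType K)
    (r : nat) (pr : I -> I) (t v : tree I) (f : tree I -> nat) :
    (0 < r)%N -> (forall i, r <= \dim {: V i})%N -> involutive pr ->
    uniq (leaves t) -> vertex v t ->
    TNS t f (tfull (pair_vec V r pr [set: I] 0)) ->
  (r ^ #|[set i in leafset v | pr i \notin leafset v]| <= f v)%N.
Proof.
move=> r0 dV inv ut vt xT; set O := finset _.
pose F := {ffun {i | i \in O} -> 'I_r}.
(* The default 0 is the index required at unpaired leaves, and it makes the ends of unseparated
   pairs agree. *)
pose val_at (b : F) i : 'I_r := oapp b (Ordinal r0) (insub i).
(* A separated pair reads [b] at its inner end and [c] at its outer end, so the tensor is 1 exactly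
   when [b = c]. *)
pose Z (b c : F) : mindex V := [ffun i => widen_ord (dV i)
  (if i \in leafset v then val_at b i else val_at c (pr i))].
have -> : (r ^ #|O| = #|F|)%N by rewrite card_ffun card_ord card_sig.
apply: (@TNS_flattening _ _ _ _ _ _ _ _ Z ut vt xT) => [b c c' i iv|b b' c i iv|b c].
- by rewrite !ffunE iv.
- by rewrite !ffunE (negPf iv).
have ZE i : mval (mrestrT [set: I] (Z b c)) i =
    if i \in leafset v then val_at b i else val_at c (pr i).
  by rewrite mval_mrestrT ?inE // ffunE.
have off (d : F) i : i \notin O -> val_at d i = 0 :> nat.
  by move=> iO; rewrite /val_at insubF ?(negPf iO).
rewrite !ffunE; congr (nat_of_bool _)%:R; apply/forall_inP/eqP => [ok|bc i _].
  apply/ffunP => -[i iO]; have := iO; rewrite inE => /andP[iv pv].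
  have := ok i (in_setT _); rewrite !ZE iv (negPf pv) inE inv.
  case: (eqVneq (pr i) i) => [pi|_ /andP[_]]; first by rewrite pi iv in pv.
  by rewrite /val_at insubT /= eq_sym => /eqP/val_inj.
rewrite !ZE bc inE inv ltn_ord /=.
case: (eqVneq (pr i) i) => [pi|_].
  by rewrite pi if_same off // inE pi andbN.
case iv: (i \in leafset v); case pv: (pr i \in leafset v) => //.
all: by rewrite !off ?inE ?inv ?iv ?pv.
Qed.

Theorem theorem1p2 (K : fieldType) (r k : nat) (r_ge1 : (1 <= r)%N)
    (k_ge1 : (1 <= k)%N) (V : 'I_(2 ^ k) -> vectType K)
    (dimV : forall i, (r <= \dim {: V i})%N)
    (r' : nat) (r'_lt : (r' < r ^ uphalf k)%N) (sigma : 'S_(2 ^ k)) :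
  ~ (forall t : tensor V, HF r t -> TT sigma r' t).
Proof.
have ms i : i \in codom sigma by rewrite -[i](permKV sigma) codom_f.
have tauI : injective (fun i => index i (codom sigma)).
  by move=> i j; apply: index_inj; rewrite ?ms.
have [j [pr ppr cr]] := perfect_crossing (@inj_id _) tauI k_ge1.
have up : (0 < uphalf k)%N by lia.
have [inv _ _] := ppr.
have ut := perm_uniq (perfect_bij_labelled k); rewrite enum_uniq in ut.
move=> sub; have := sub _ (TNS_pair_vec V ut ppr r_ge1).
rewrite leafset_bij; last exact: perfect_bij_labelled.
rewrite /TT; case Es : (codom sigma) => [//|x s].
have ux : uniq (leaves (train_tree x s)).
  by rewrite leaves_train -Es map_inj_uniq ?enum_uniq //; exact: perm_inj.
(* A crossing leaf forces [j] to be positive and at most the number of leaves. *)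
have [i ic] : exists i, i \in crossing (index^~ (codom sigma)) j pr.
  exact/card_gt0P/(leq_trans up).
have [v vt vE] : exists2 v, vertex v (train_tree x s) &
    leafset v = [set y in take j (codom sigma)].
  move: ic; rewrite inE Es => /andP[j1 j2]; apply/leafset_train.
  have js : (j <= (size s).+1)%N.
    by apply: (leq_trans j2); rewrite -[(size s).+1]/(size (x :: s)) index_size.
  (* The prefix of length 1 is a leaf of the train track, the longer ones are nodes. *)
  have [jle1|jgt1] := leqP j 1; last by right; exists j; rewrite ?jgt1.
  left; exists x; first exact: mem_head.
  case: j j1 jle1 {cr j2 js} => [|[]] // _ _; rewrite /= take0.
  by apply/setP => y; rewrite !inE.
move/(crossing_flattening r_ge1 dimV inv ux vt); apply/negP; rewrite -ltnNge.
apply: (leq_trans r'_lt); apply: leq_pexp2l => //.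
apply: (leq_trans cr); apply/subset_leq_card/subsetP => y.
by rewrite !inE vE !inE !in_take // -leqNgt.
Qed.
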